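(* Let $n\ge2$, let $[m_{-n},\dots,m_{-1}]$ be a highest weight of a finite-dimensional irreducible representation of $\mathfrak{o}_{2n+1}$ and let $r_{-k}=m_{-k}-m_{-k+1}$ for $k=2,\dots,n$ and $r_{-1}=2m_{-1}$. Let $\mathcal{S}^{B}$ be the space of polynomial solutions of the indicator system of type $B$ with exponents $(r_{-n},\dots,r_{-2},r_{-1})$, and let $\mathcal{S}^{A}$ be the space of polynomial solutions of the indicator system of type $A$ with exponents $(r_{-n},\dots,r_{-2},[r_{-1}/2])$, where $[\cdot]$ denotes the integer part. Then the correspondence $$(p_{-1},\,p_{-k},\,q_{-k})_{k=2,\dots,n}\longmapsto \Bigl(p'_{-1}=\tfrac{p_{-1}}{2},\,p_{-k},\,q_{-k}\Bigr)_{k=2,\dots,n}$$ (that is, the linear map sending the monomial $B_{p_{-1},p,q}$ with $p_{-1}$ even to the monomial $A_{p_{-1}/2,\,p,q}$) gives a bijection between the subspace of those solutions in $\mathcal{S}^{B}$ whose expansion contains only monomials $B_{p_{-1},p,q}$ with even $p_{-1}$ and the whole space $\mathcal{S}^{A}$.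
   Context: Highest weights of finite-dimensional irreducible representations of $\mathfrak{o}_{2n+1}$ are sequences $m_{-n}\ge\dots\ge m_{-1}\ge0$, all integers or all half-integers (in $\frac12+\mathbb{Z}$). Indicator system of type $B$ with exponents $(r_{-n},\dots,r_{-1})$ (describing $\mathfrak{o}_{2n-1}$-highest vectors): for complex polynomials $f$ in the variables $z_{-k,-1},z_{-k,1}$ ($k=2,\dots,n$) and $z_{0,1}$, $$\Bigl(z_{-k+1,-1}\tfrac{\partial}{\partial z_{-k,-1}}+z_{-k+1,1}\tfrac{\partial}{\partial z_{-k,1}}\Bigr)^{r_{-k}+1}f=0\quad(k=3,\dots,n),$$ $$\Bigl(\tfrac{\partial}{\partial z_{-2,-1}}+\tfrac{z_{0,1}^2}{2}\tfrac{\partial}{\partial z_{-2,1}}\Bigr)^{r_{-2}+1}f=0,\qquad \Bigl(\tfrac{\partial}{\partial z_{0,1}}\Bigr)^{r_{-1}+1}f=0.$$ Put $u_{-k}=z_{-k,1}+\frac{z_{0,1}^2}{2}z_{-k,-1}$, $v_{-k}=z_{-k,1}-\frac{z_{0,1}^2}{2}z_{-k,-1}$ ($k=2,\dots,n$), $u_{-1}=z_{0,1}$, and $$B_{p_{-1},p,q}=u_{-1}^{p_{-1}}\prod_{k=2}^n(u_{-k}+v_{-k})^{p_{-k}}(u_{-k}-v_{-k})^{q_{-k}},\qquad p_{-k},q_{-k}\in\mathbb{Z}_{\ge0},\ p_{-1}\in\mathbb{Z},\ p_{-1}+2\sum_{k=2}^n q_{-k}\ge0.$$ These form a basis of the space of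 polynomials in the $z_{-k,\pm1}$ and $z_{0,1}$ ($p_{-1}$ may be negative). Indicator system of type $A$ with exponents $(\rho_{-n},\dots,\rho_{-1})$ (describing $\mathfrak{gl}_{n-1}$-highest vectors in a representation of $\mathfrak{gl}_{n+1}$): for complex polynomials $f$ in $z_{-k,-1},z_{-k,1}$ ($k=2,\dots,n$) and $z_{-1,1}$, $$\Bigl(z_{-k+1,-1}\tfrac{\partial}{\partial z_{-k,-1}}+z_{-k+1,1}\tfrac{\partial}{\partial z_{-k,1}}\Bigr)^{\rho_{-k}+1}f=0\quad(k=3,\dots,n),$$ $$\Bigl(\tfrac{\partial}{\partial z_{-2,-1}}+z_{-1,1}\tfrac{\partial}{\partial z_{-2,1}}\Bigr)^{\rho_{-2}+1}f=0,\qquad \Bigl(\tfrac{\partial}{\partial z_{-1,1}}\Bigr)^{\rho_{-1}+1}f=0.$$ Put $x_{-k}=z_{-k,1}+z_{-1,1}z_{-k,-1}$, $y_{-k}=z_{-k,1}-z_{-1,1}z_{-k,-1}$ ($k=2,\dots,n$), $x_{-1}=z_{-1,1}$, and $$A_{p_{-1},p,q}=x_{-1}^{p_{-1}}\prod_{k=2}^n(x_{-k}+y_{-k})^{p_{-k}}(x_{-k}-y_{-k})^{q_{-k}},\qquad p_{-k},q_{-k}\in\mathbb{Z}_{\ge0},\ p_{-1}\in\mathbb{Z},\ p_{-1}+\sum_{k=2}^n q_{-k}\ge0.$$ These form a basis of the space of polynomials in the $z_{-k,\pm1}$ and $z_{-1,1}$. *)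

(* Defs.v *)
From HB Require Import structures.
From mathcomp Require Import all_boot all_order all_algebra.
From mathcomp Require Import boolp classical_sets functions reals.
From mathcomp Require Import finmap mpoly complex.

Set Implicit Arguments.
Unset Strict Implicit.
Unset Printing Implicit Defensive.

Import Order.TTheory GRing.Theory Num.Theory.
Local Open Scope ring_scope.

Local Notation "x %:F" := (@tofrac _ x) : ring_scope.

(* Negative indices are written without their sign: for a sequence m,           *)
(* (m k) stands for m_{-k}, 1 <= k <= n; other values of m are irrelevant.      *)
Definition highest_weight (n : nat) (m : nat -> rat) : Prop :=
  [/\ forall k : nat, (1 <= k < n)%N -> m k <= m k.+1,
      0 <= m 1%N &
      (forall k : nat, (1 <= k <= n)%N -> m k \is a Num.int) \/
      (forall k : nat, (1 <= k <= n)%N -> m k - 2^-1 \is a Num.int)].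

(* The 2n - 1 variables of either system. Variable 0 is z_{0,1} in type B and   *)
(* z_{-1,1} in type A; for 2 <= k <= n, variable 2k - 3 is z_{-k,-1} and        *)
(* variable 2k - 2 is z_{-k,1}.                                                 *)
Definition nvars (n : nat) : nat := (n.-1.*2).+1.
Definition ivar0 (n : nat) : 'I_(nvars n) := ord0.
Definition ivarm (n k : nat) : 'I_(nvars n) := inord (k.*2 - 3).
Definition ivarp (n k : nat) : 'I_(nvars n) := inord (k.*2 - 2).

Section Systems.
Variables (R : realType) (n : nat).

Definition zpoly := {mpoly R[i][nvars n]}.

Definition z0 : zpoly := 'X_(ivar0 n).
Definition zm (k : nat) : zpoly := 'X_(ivarm n k).
Definition zp (k : nat) : zpoly := 'X_(ivarp n k).

Definition shift_op (k : nat) (f : zpoly) : zpoly :=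
  zm k.-1 * f^`M(ivarm n k) + zp k.-1 * f^`M(ivarp n k).

Definition opB2 (f : zpoly) : zpoly :=
  f^`M(ivarm n 2) + (2^-1 *: z0 ^+ 2) * f^`M(ivarp n 2).

Definition opA2 (f : zpoly) : zpoly :=
  f^`M(ivarm n 2) + z0 * f^`M(ivarp n 2).

Definition op1 (f : zpoly) : zpoly := f^`M(ivar0 n).

Definition solB (r : nat -> nat) : set zpoly := [set f |
  [/\ forall k : nat, (3 <= k <= n)%N -> iter (r k).+1 (shift_op k) f = 0,
      iter (r 2%N).+1 opB2 f = 0 &
      iter (r 1%N).+1 op1 f = 0]]%classic.

Definition solA (rho : nat -> nat) : set zpoly := [set f |
  [/\ forall k : nat, (3 <= k <= n)%N -> iter (rho k).+1 (shift_op k) f = 0,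
      iter (rho 2%N).+1 opA2 f = 0 &
      iter (rho 1%N).+1 op1 f = 0]]%classic.

Definition uB (k : nat) : zpoly := zp k + (2^-1 *: z0 ^+ 2) * zm k.
Definition vB (k : nat) : zpoly := zp k - (2^-1 *: z0 ^+ 2) * zm k.
Definition xA (k : nat) : zpoly := zp k + z0 * zm k.
Definition yA (k : nat) : zpoly := zp k - z0 * zm k.

(* (p_{-1}, p, q), where (p i) and (q i) stand for p_{-(i+2)} and q_{-(i+2)},   *)
(* 0 <= i < n - 1.                                                              *)
Definition expo : Type := (int * {ffun 'I_n.-1 -> nat} * {ffun 'I_n.-1 -> nat})%type.

Definition admB (e : expo) : bool :=
  let: (p1, _, q) := e in 0 <= p1 + 2 * (\sum_(i < n.-1) q i)%N%:Z.

Definition admA (e : expo) : bool :=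
  let: (p1, _, q) := e in 0 <= p1 + (\sum_(i < n.-1) q i)%N%:Z.

(* As p_{-1} may be negative, the monomials are taken in the field of rational  *)
(* functions; x%:F is the image there of a polynomial x.                        *)
Definition monB (e : expo) : {fraction zpoly} :=
  let: (p1, p, q) := e in
  z0%:F ^ p1 * \prod_(i < n.-1) ((uB i.+2 + vB i.+2)%:F ^+ p i *
                        (uB i.+2 - vB i.+2)%:F ^+ q i).

Definition monA (e : expo) : {fraction zpoly} :=
  let: (p1, p, q) := e in
  z0%:F ^ p1 * \prod_(i < n.-1) ((xA i.+2 + yA i.+2)%:F ^+ p i *
                        (xA i.+2 - yA i.+2)%:F ^+ q i).

Definition expansionB (c : {fsfun expo -> R[i] with 0}) (f : zpoly) : Prop :=
  (forall e, e \in finsupp c -> admB e) /\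
  f%:F = \sum_(e <- finsupp c) ((c e)%:MP : zpoly)%:F * monB e.

Definition evenexp (e : expo) : bool := (2 %| e.1.1)%Z.

Definition evenB : set zpoly := [set f |
  exists2 c : {fsfun expo -> R[i] with 0},
    expansionB c f & forall e, e \in finsupp c -> evenexp e]%classic.

Definition halfexp (e : expo) : expo := ((e.1.1 %/ 2)%Z, e.1.2, e.2).

(* Only the restriction of Phi to the span of the B-monomials with even p_{-1}  *)
(* is prescribed; its values on the other ones are arbitrary.                   *)
Definition sends_B_to_A (Phi : {linear zpoly -> zpoly}) : Prop :=
  forall e : expo, admB e -> evenexp e ->
  forall b : zpoly, b%:F = monB e -> (Phi b)%:F = monA (halfexp e).

End Systems.

Definition exponentsA (r : nat -> nat) (k : nat) : nat :=
  if k == 1%N then (r 1%N %/ 2)%N else r k.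

(* Main.v *)
Require Import Defs.
From HB Require Import structures.
From mathcomp Require Import all_boot all_order all_algebra.
From mathcomp Require Import boolp classical_sets functions reals.
From mathcomp Require Import finmap mpoly ssrcomplements complex zify.

Set Implicit Arguments.
Unset Strict Implicit.
Unset Printing Implicit Defensive.

Import Order.TTheory GRing.Theory Num.Theory.
Local Open Scope ring_scope.

(** The two families of products hide ordinary monomials. Since
    [u_{-k} + v_{-k} = 2 z_{-k,1}] and [u_{-k} - v_{-k} = z_{0,1}^2 z_{-k,-1}],
    while [x_{-k} + y_{-k} = 2 z_{-k,1}] and
    [x_{-k} - y_{-k} = 2 z_{-1,1} z_{-k,-1}], a B-product with even exponent
    [p_{-1}] becomes the corresponding A-product by reading [z_{0,1}^2] as
    [z_{-1,1}] and rescaling each [z_{-k,-1}] by 2. In the other direction this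
    is a substitution defined on all polynomials: the algebra morphism
      [Psi : z_{-1,1} |-> z_{0,1}^2, z_{-k,-1} |-> z_{-k,-1} / 2,
             z_{-k,1} |-> z_{-k,1}],
    which carries the A-product with exponents [(p_{-1}, p, q)] to the
    B-product with exponents [(2 p_{-1}, p, q)] ([Psi_polyA]).

    As the A-products span all polynomials ([mpolyX_polyA]), the image of [Psi]
    is the span of the B-products with even [p_{-1}] ([evenB_Psi]), and a linear
    map extends the prescribed correspondence exactly when it is a left inverse
    of [Psi] ([sends_B_to_AP]). Such left inverses exist because [Psi] sends
    distinct monomials to nonzero multiples of distinct monomials
    ([msubst_linear_retraction]). The bijection therefore reduces to one fact:
    [Psi f] solves the B-system if and only if [f] solves the A-system
    ([solB_Psi]).

    For every operator but the last, this holds because [Psi] intertwines a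
    nonzero multiple of the A-operator with the B-operator: with respect to
    [z_{-k,-1}] and [z_{-k,1}] the chain rule only produces the scaling
    constants 1/2 and 1. The last operator is [d/dz_{0,1}], whose iterates
    bound a degree: [Psi] doubles the degree in that variable, and
    [2 d <= r_{-1}] holds exactly when [d] is at most the integer part of
    [r_{-1} / 2]. *)

(** * Linear maps on polynomial spaces *)

Section LinearExtension.
Variables (K : fieldType) (N : nat) (V : lmodType K) (h : 'X_{1..N} -> V).

Definition linext (f : {mpoly K[N]}) : V := \sum_(m <- msupp f) f@_m *: h m.

Lemma linextwE k f : (msize f <= k)%N ->
  linext f = \sum_(m : 'X_{1..N < k}) f@_m *: h m.
Proof.
move=> fk; rewrite /linext (big_mksub 'X_{1..N < k}) ?msupp_uniq //=.
  by rewrite big_rmcond //= => m /memN_msupp_eq0 ->; rewrite scale0r.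
by move=> m /msize_mdeg_lt /leq_trans; apply.
Qed.

Lemma linext_linear : linear linext.
Proof.
move=> c f g; set k := maxn (msize (c *: f + g)) (maxn (msize f) (msize g)).
have [kfg kf kg] : [/\ msize (c *: f + g) <= k, msize f <= k & msize g <= k]%N.
  by split; rewrite /k !leq_max leqnn ?orbT.
rewrite (linextwE kfg) (linextwE kf) (linextwE kg) scaler_sumr -big_split /=.
by apply: eq_bigr => m _; rewrite mcoeffD mcoeffZ scalerDl scalerA.
Qed.

HB.instance Definition _ := GRing.isLinear.Build K {mpoly K[N]} V *:%R linext
  linext_linear.

Lemma linextX m : linext 'X_[m] = h m.
Proof. by rewrite /linext msuppX big_seq1 mcoeffX eqxx scale1r. Qed.

End LinearExtension.

Lemma linear_mpoly_ext (K : fieldType) (N : nat) (V : lmodType K)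
    (F G : {linear {mpoly K[N]} -> V}) :
  (forall m, F 'X_[m] = G 'X_[m]) -> F =1 G.
Proof.
move=> FG f; rewrite (mpolyE f) !linear_sum /=.
by apply: eq_bigr => m _; rewrite !linearZ /= FG.
Qed.

(** In characteristic zero the falling factorials produced by iterated
    differentiation do not vanish. *)
Lemma iter_mderiv_eq0 (K : numFieldType) (N : nat) (i : 'I_N) k
    (f : {mpoly K[N]}) :
  iter k (mderiv i) f = 0 <-> forall m : 'X_{1..N}, (k <= m i)%N -> f@_m = 0.
Proof.
rewrite -mderivn_iter; split=> [f0 m km | fk].
  have km' : (U_(i) *+ k <= m)%MM.
    apply/mnm_lepP => j; rewrite mulmnE mnm1E.
    by case: eqP => [<-|_]; rewrite ?mul1n ?mul0n.
  have /mpolyP/(_ (m - U_(i) *+ k)%MM) := f0.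
  rewrite mcoeff_mderivm mcoeff0 addmC submK // => /eqP.
  rewrite mulrn_eq0 -leqn0 => /orP[|/eqP //].
  rewrite leqNgt prodn_gt0 // => j; rewrite ffact_gt0.
  exact: (mnm_lepP km').
apply/mpolyP => m; rewrite mcoeff_mderivm mcoeff0 fk ?mul0rn //.
by rewrite mnmDE mulmnE mnm1E eqxx mul1n leq_addr.
Qed.

(** * Substitutions of the form X_i |-> s_i X_i^d_i *)

Section MonomialSubstitution.
Variables (K : numFieldType) (N : nat) (s : 'I_N -> K) (d : 'I_N -> nat).
Hypotheses (s_neq0 : forall i, s i != 0) (d_gt0 : forall i, (0 < d i)%N).

Definition msubst (f : {mpoly K[N]}) : {mpoly K[N]} :=
  f \mPo [tuple s i *: 'X_i ^+ d i | i < N].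

HB.instance Definition _ := GRing.LRMorphism.copy msubst
  (comp_mpoly [tuple s i *: ('X_i : {mpoly K[N]}) ^+ d i | i < N]).

Definition mscale (m : 'X_{1..N}) : 'X_{1..N} := [multinom d i * m i | i < N]%N.

Definition mweight (m : 'X_{1..N}) : K := \prod_i s i ^+ m i.

Lemma mweight_neq0 m : mweight m != 0.
Proof. by apply/prodf_neq0 => i _; rewrite expf_neq0. Qed.

Lemma mscale_inj : injective mscale.
Proof.
move=> m m' /mnmP mm; apply/mnmP => i; have := mm i; rewrite !mnmE => /eqP.
by rewrite eqn_pmul2l // => /eqP.
Qed.

Lemma msubstXi i : msubst 'X_i = s i *: 'X_i ^+ d i.
Proof. by rewrite /msubst comp_mpolyXU -tnth_nth tnth_mktuple. Qed.

Lemma msubstX m : msubst 'X_[m] = mweight m *: 'X_[mscale m].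
Proof.
rewrite /msubst comp_mpolyX [in RHS]mpolyXE_id /mweight -scaler_prod.
by apply: eq_bigr => i _; rewrite tnth_mktuple exprZn -exprM mnmE.
Qed.

Lemma msubstE f :
  msubst f = \sum_(m <- msupp f) (f@_m * mweight m) *: 'X_[mscale m].
Proof.
rewrite [in LHS](mpolyE f) linear_sum /=; apply: eq_bigr => m _.
by rewrite linearZ /= msubstX scalerA.
Qed.

Lemma mcoeff_msubst f m : (msubst f)@_(mscale m) = f@_m * mweight m.
Proof.
rewrite msubstE [RHS]mulrC [in RHS](mpolyE f) raddf_sum [X in _ = _ * X]raddf_sum.
rewrite mulr_sumr /=.
apply: eq_bigr => m' _; rewrite !mcoeffZ !mcoeffX (inj_eq mscale_inj).
by case: eqP => [->|_]; rewrite ?mulr0 // !mulr1 mulrC.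
Qed.

Lemma mcoeff_msubst_out f m :
  (forall m', m' \in msupp f -> mscale m' != m) -> (msubst f)@_m = 0.
Proof.
move=> mout; rewrite msubstE raddf_sum big_seq big1 //= => m' /mout.
by rewrite mcoeffZ mcoeffX => /negPf ->; rewrite mulr0.
Qed.

(** Monomials go to nonzero multiples of distinct monomials, so dividing the
    exponents by the [d i] and undoing the scaling is a left inverse. On the
    monomials outside the image the truncated quotient is a harmless default:
    a retraction may take any values there. *)
Lemma msubst_linear_retraction :
  exists P : {linear {mpoly K[N]} -> {mpoly K[N]}}, cancel msubst P.
Proof.
pose h m := let m' := [multinom m i %/ d i | i < N]%N in
  (mweight m')^-1 *: 'X_[K, m'].
exists (linext h) => f; rewrite -[LHS]/((linext h \o msubst) f) -[RHS]/(idfun f).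
apply: linear_mpoly_ext => m /=; rewrite msubstX linearZ /= linextX /h.
have -> : [multinom mscale m i %/ d i | i < N] = m.
  by apply/mnmP => i; rewrite !mnmE mulKn.
by rewrite scalerA divff ?mweight_neq0 // scale1r.
Qed.

(** The chain rule for a variable that is only rescaled. *)
Lemma mderiv_msubst i f : d i = 1%N ->
  (msubst f)^`M(i) = s i *: msubst f^`M(i).
Proof.
move=> di; rewrite -[LHS]/((mderiv i \o msubst) f).
rewrite -[RHS]/((s i \*: (msubst \o mderiv i)) f).
apply: linear_mpoly_ext => m /=.
rewrite msubstX mderivX [msubst (_ *: _)]linearZ /= msubstX linearZ /= mderivX.
rewrite !scalerA mnmE di mul1n.
have [->|mi] := posnP (m i); first by rewrite !(mulr0, mul0r) !scale0r.
have mE : m = (m - U_(i) + U_(i))%MM.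
  rewrite submK //; apply/mnm_lepP => j; rewrite mnm1E.
  by case: eqP => // <-.
have mscaleE : (mscale m - U_(i))%MM = mscale (m - U_(i)).
  apply/mnmP => j; rewrite !mnmE.
  by case: eqP => [<-|_]; rewrite ?subn0 // di !mul1n.
have weightE : mweight m = s i * mweight (m - U_(i)).
  rewrite /mweight {1}mE.
  under eq_bigr do rewrite mnmDE exprD.
  rewrite big_split /= mulrC; congr (_ * _).
  rewrite (bigD1 i) //= mnm1E eqxx expr1 big1 ?mulr1 // => j ji.
  by rewrite mnm1E eq_sym (negPf ji).
by rewrite mscaleE weightE mulrAC.
Qed.

End MonomialSubstitution.

(** * The substitution from type A to type B *)

Lemma big_ord_double (T : Type) (idx : T) (op : Monoid.law idx) k (F : nat -> T) :
  \big[op/idx]_(i < k.*2) F i = \big[op/idx]_(i < k) op (F i.*2) (F i.*2.+1).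
Proof.
elim: k => [|k IHk]; first by rewrite !big_ord0.
by rewrite doubleS !big_ord_recr /= IHk Monoid.mulmA.
Qed.

(** If [h] intertwines [f] with [c^-1 g] then it intertwines their iterates up to
    a power of [c], which cannot affect vanishing. Thus annihilation by an iterate
    transfers along an injective [h]. *)
Lemma iter_intertwine_eq0 (K : fieldType) (V W : lmodType K) (c : K)
    (h : {linear V -> W}) (f : V -> V) (g : {linear W -> W}) N x :
    c != 0 -> injective h -> (forall y, g (h y) = c *: h (f y)) ->
  iter N g (h x) = 0 <-> iter N f x = 0.
Proof.
move=> c0 h_inj gh; suff -> : iter N g (h x) = c ^+ N *: h (iter N f x).
  split=> [/eqP|->]; last by rewrite linear0 scaler0.
  rewrite scaler_eq0 expf_eq0 (negPf c0) andbF /= => /eqP hf0.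
  by apply: h_inj; rewrite hf0 linear0.
elim: N => [|N IHN]; first by rewrite scale1r.
by rewrite !iterS IHN linearZ /= gh scalerA exprSr.
Qed.

Section Correspondence.
Variables (R : realType) (n : nat).
Local Notation zpoly := (zpoly R n).
Local Notation "x %:F" := (@tofrac _ x) : ring_scope.

(** The odd-numbered variables are the [z_{-k,-1}]. *)
Definition scoef (i : 'I_(nvars n)) : R[i] := if odd i then 2^-1 else 1.
Definition sdeg (i : 'I_(nvars n)) : nat := if i == ivar0 n then 2 else 1.

Definition Psi : zpoly -> zpoly := msubst scoef sdeg.

HB.instance Definition _ := GRing.LRMorphism.copy Psi (msubst scoef sdeg).

Lemma scoef_neq0 i : scoef i != 0.
Proof. by rewrite /scoef; case: ifP; rewrite ?oner_neq0 // invr_neq0 ?pnatr_eq0. Qed.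

Lemma sdeg_gt0 i : (0 < sdeg i)%N.
Proof. by rewrite /sdeg; case: ifP. Qed.

Lemma val_ivarm k : (2 <= k <= n)%N -> ivarm n k = (k.*2 - 3)%N :> nat.
Proof. by move=> kn; rewrite inordK // /nvars; lia. Qed.

Lemma val_ivarp k : (2 <= k <= n)%N -> ivarp n k = (k.*2 - 2)%N :> nat.
Proof. by move=> kn; rewrite inordK // /nvars; lia. Qed.

Lemma sdeg_ivarm k : (2 <= k <= n)%N -> sdeg (ivarm n k) = 1%N.
Proof.
by move=> kn; rewrite /sdeg -val_eqE /= val_ivarm //; case: eqP => //=; lia.
Qed.

Lemma sdeg_ivarp k : (2 <= k <= n)%N -> sdeg (ivarp n k) = 1%N.
Proof.
by move=> kn; rewrite /sdeg -val_eqE /= val_ivarp //; case: eqP => //=; lia.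
Qed.

Lemma scoef_ivarm k : (2 <= k <= n)%N -> scoef (ivarm n k) = 2^-1.
Proof. by move=> kn; rewrite /scoef val_ivarm // ifT //; lia. Qed.

Lemma scoef_ivarp k : (2 <= k <= n)%N -> scoef (ivarp n k) = 1.
Proof. by move=> kn; rewrite /scoef val_ivarp // ifF //; lia. Qed.

Lemma Psi_z0 : Psi (z0 R n) = z0 R n ^+ 2.
Proof. by rewrite /Psi msubstXi /scoef /= scale1r /sdeg eqxx. Qed.

Lemma Psi_zm k : (2 <= k <= n)%N -> Psi (zm R n k) = 2^-1 *: zm R n k.
Proof. by move=> kn; rewrite /Psi msubstXi scoef_ivarm // sdeg_ivarm. Qed.

Lemma Psi_zp k : (2 <= k <= n)%N -> Psi (zp R n k) = zp R n k.
Proof. by move=> kn; rewrite /Psi msubstXi scoef_ivarp // sdeg_ivarp // scale1r. Qed.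

Lemma mderiv_Psi_zm k f : (2 <= k <= n)%N ->
  (Psi f)^`M(ivarm n k) = 2^-1 *: Psi f^`M(ivarm n k).
Proof.
by move=> kn; rewrite /Psi mderiv_msubst ?scoef_ivarm ?sdeg_ivarm.
Qed.

Lemma mderiv_Psi_zp k f : (2 <= k <= n)%N ->
  (Psi f)^`M(ivarp n k) = Psi f^`M(ivarp n k).
Proof.
by move=> kn; rewrite /Psi mderiv_msubst ?scoef_ivarp ?sdeg_ivarp ?scale1r.
Qed.

Lemma shift_op_Psi k f : (3 <= k <= n)%N ->
  shift_op k (Psi f) = Psi (shift_op k f).
Proof.
move=> kn; rewrite /shift_op rmorphD !rmorphM /= Psi_zm ?Psi_zp; try lia.
rewrite mderiv_Psi_zm ?mderiv_Psi_zp; try lia.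
by rewrite -scalerAr -scalerAl.
Qed.

(** The factor 1/2 in front of the quadratic term of [opB2] is matched by the
    one that [Psi] gives to [z_{-2,-1}]. *)
Lemma opB2_Psi f : (2 <= n)%N -> opB2 (Psi f) = 2^-1 *: Psi (opA2 f).
Proof.
move=> hn; rewrite /opB2 /opA2 rmorphD rmorphM /= Psi_z0 scalerDr.
by rewrite mderiv_Psi_zm ?mderiv_Psi_zp // -scalerAl.
Qed.

Lemma Psi_retraction : exists P : {linear zpoly -> zpoly}, cancel Psi P.
Proof. exact: (msubst_linear_retraction scoef_neq0 sdeg_gt0). Qed.

Lemma Psi_inj : injective Psi.
Proof. by case: Psi_retraction => P /can_inj. Qed.

Lemma shift_op_linear k : linear (@shift_op R n k).
Proof.
by move=> c f g; rewrite /shift_op !linearP /= !mulrDr -!scalerAr addrACA scalerDr.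
Qed.

HB.instance Definition _ k := GRing.isLinear.Build _ _ _ _ (@shift_op R n k)
  (shift_op_linear k).

Lemma opB2_linear : linear (@opB2 R n).
Proof.
by move=> c f g; rewrite /opB2 !linearP /= !mulrDr -!scalerAr addrACA scalerDr.
Qed.

HB.instance Definition _ := GRing.isLinear.Build _ _ _ _ (@opB2 R n) opB2_linear.

(** [Psi] multiplies every exponent of [z0] by 2, and an integer [d] satisfies
    [2 d <= N] if and only if [d <= N %/ 2]. *)
Lemma iter_op1_Psi N f :
  iter N.+1 (@op1 R n) (Psi f) = 0 <-> iter (N %/ 2).+1 (@op1 R n) f = 0.
Proof.
rewrite !iter_mderiv_eq0; split=> fN m mN.
  have m0N : (N.+1 <= mscale sdeg m (ivar0 n))%N.
    by rewrite mnmE /sdeg eqxx; lia.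
  move/eqP: (fN _ m0N); rewrite (mcoeff_msubst scoef sdeg_gt0) mulf_eq0.
  by rewrite (negPf (mweight_neq0 scoef_neq0 m)) orbF => /eqP.
apply: mcoeff_msubst_out => m'; rewrite mcoeff_msupp; apply: contra => /eqP m'm.
by apply/eqP/fN; move: mN; rewrite -m'm mnmE /sdeg eqxx; lia.
Qed.

Lemma solB_Psi r f : (2 <= n)%N -> solB r (Psi f) <-> solA (exponentsA r) f.
Proof.
move=> hn.
have eq3 k N : (3 <= k <= n)%N ->
    iter N (@shift_op R n k) (Psi f) = 0 <-> iter N (@shift_op R n k) f = 0.
  move=> kn; apply: (iter_intertwine_eq0 _ _ (oner_neq0 _) Psi_inj) => y.
  by rewrite scale1r; apply: shift_op_Psi.
have eq2 N : iter N (@opB2 R n) (Psi f) = 0 <-> iter N (@opA2 R n) f = 0.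
  have half_neq0 : (2^-1 : R[i]) != 0 by rewrite invr_neq0 ?pnatr_eq0.
  apply: (iter_intertwine_eq0 _ _ half_neq0 Psi_inj) => y.
  exact: opB2_Psi.
have r3 k : (3 <= k <= n)%N -> exponentsA r k = r k.
  by move=> kn; rewrite /exponentsA ifF //; lia.
split=> -[f3 f2 f1]; split.
- by move=> k kn; rewrite (r3 k kn); exact: (iffLR (eq3 k _ kn) (f3 k kn)).
- exact: (iffLR (eq2 _) f2).
- exact: (iffLR (iter_op1_Psi _ _) f1).
- by move=> k kn; move: (f3 k kn); rewrite (r3 k kn); exact: (iffRL (eq3 k _ kn)).
- exact: (iffRL (eq2 _) f2).
- exact: (iffRL (iter_op1_Psi _ _) f1).
Qed.

(** * Polynomial forms of the two bases *)

(** On admissible exponents the negative power of [z0] is absorbed by the powers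
    that the factors [x - y], resp. [u - v], contribute; [polyA] and [polyB] carry
    out this cancellation, so that they live in the polynomial ring. The absolute
    value only serves to read a nonnegative integer as a natural number. *)
Definition polyA (e : expo n) : zpoly := let: (p1, p, q) := e in
  z0 R n ^+ `|(p1 + (\sum_(i < n.-1) q i)%N%:Z)%R|%N *
  \prod_(i < n.-1) ((2 *: zp R n i.+2) ^+ p i * (2 *: zm R n i.+2) ^+ q i).

Definition polyB (e : expo n) : zpoly := let: (p1, p, q) := e in
  z0 R n ^+ `|(p1 + 2 * (\sum_(i < n.-1) q i)%N%:Z)%R|%N *
  \prod_(i < n.-1) ((2 *: zp R n i.+2) ^+ p i * zm R n i.+2 ^+ q i).

Lemma z0_neq0 : (z0 R n)%:F != 0.
Proof.
rewrite tofrac_eq0 /z0 -msupp_eq0 msuppX; exact: isT.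
Qed.

Lemma fracXz (a : int) (k : nat) : 0 <= a + k%:Z ->
  (z0 R n ^+ `|(a + k%:Z)%R|%N)%:F = (z0 R n)%:F ^ a * (z0 R n)%:F ^+ k.
Proof.
move=> ak; rewrite rmorphXn /= !exprnP -expfzDr ?z0_neq0 //.
by rewrite gez0_abs.
Qed.

Lemma monA_polyA e : admA e -> monA R e = (polyA e)%:F.
Proof.
case: e => [[p1 p] q] /= adm; rewrite rmorphM /= fracXz // rmorph_prod /= -mulrA.
congr (_ * _); rewrite expr_sum -big_split /=; apply: eq_bigr => i _.
rewrite rmorphM !rmorphXn mulrCA; congr (_ ^+ _ * _).
  by rewrite /xA /yA addrACA subrr addr0 scaler_nat -mulr2n.
rewrite -exprMn -rmorphM /=; congr (_%:F ^+ _).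
by rewrite /xA /yA opprB addrC addrA subrK -mulr2n scaler_nat mulrnAr.
Qed.

Lemma monB_polyB e : admB e -> monB R e = (polyB e)%:F.
Proof.
case: e => [[p1 p] q] /= adm; rewrite -PoszM.
rewrite rmorphM /= fracXz // rmorph_prod /= -mulrA.
congr (_ * _); rewrite exprM expr_sum -big_split /=; apply: eq_bigr => i _.
rewrite rmorphM !rmorphXn mulrCA; congr (_ ^+ _ * _).
  by rewrite /uB /vB addrACA subrr addr0 scaler_nat -mulr2n.
rewrite -exprMn; congr (_ ^+ _).
have -> : uB R n i.+2 - vB R n i.+2 = z0 R n ^+ 2 * zm R n i.+2.
  rewrite /uB /vB opprB addrC addrA subrK -mulr2n -scalerAl -scaler_nat scalerA.
  by rewrite mulfV ?pnatr_eq0 // scale1r.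
by rewrite rmorphM rmorphXn.
Qed.

Definition dblexp (e : expo n) : expo n := (2 * e.1.1, e.1.2, e.2).

Lemma dblexpK : cancel dblexp (@halfexp n).
Proof. by case=> [[p1 p] q]; rewrite /halfexp /= mulrC mulzK. Qed.

Lemma halfexpK e : evenexp e -> dblexp (halfexp e) = e.
Proof.
by case: e => [[p1 p] q] /dvdzP [a /= ->]; rewrite /dblexp /= mulzK // mulrC.
Qed.

Lemma evenexp_dblexp e : evenexp (dblexp e).
Proof. by rewrite /evenexp /= dvdz_mulr. Qed.

Lemma admB_dblexp e : admB (dblexp e) = admA e.
Proof. by case: e => [[p1 p] q] /=; rewrite -mulrDr pmulr_rge0. Qed.

Lemma Psi_polyA e : Psi (polyA e) = polyB (dblexp e).
Proof.
case: e => [[p1 p] q] /=; rewrite rmorphM rmorphXn /= Psi_z0 -exprM.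
rewrite -mulrDr abszM; congr (_ * _); rewrite rmorph_prod /=.
apply: eq_bigr => i _; have i_n : (2 <= i.+2 <= n)%N by have := ltn_ord i; lia.
rewrite rmorphM !rmorphXn /= !linearZ /= (Psi_zm i_n) (Psi_zp i_n).
by rewrite scalerA mulfV ?pnatr_eq0 ?scale1r.
Qed.

(** The exponents of the A-product proportional to the monomial [m]: each
    [z_{-k,-1}] comes with one factor [z0], hence the subtraction. *)
Definition mexpo (m : 'X_{1..nvars n}) : expo n :=
  let q := [ffun i : 'I_n.-1 => m (ivarm n i.+2)] in
  ((m (ivar0 n))%:Z - (\sum_(i < n.-1) q i)%N%:Z,
   [ffun i : 'I_n.-1 => m (ivarp n i.+2)], q).

Lemma admA_mexpo m : admA (mexpo m).
Proof. by rewrite /= subrK. Qed.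

(** The A-products span: each is a power of 2 times a monomial, and every
    monomial arises. *)
Lemma mpolyX_polyA m : exists c : R[i], 'X_[m] = c *: polyA (mexpo m).
Proof.
pose d (i : 'I_n.-1) := (m (ivarp n i.+2) + m (ivarm n i.+2))%N.
exists (\prod_(i < n.-1) 2 ^+ d i)^-1.
suff -> : polyA (mexpo m) = (\prod_(i < n.-1) 2 ^+ d i) *: 'X_[m].
  rewrite scalerA mulVf ?scale1r //.
  by apply/prodf_neq0 => i _; rewrite expf_neq0 ?pnatr_eq0.
rewrite /= subrK absz_nat.
pose F k : zpoly := 'X_(inord k) ^+ m (inord k).
have -> : 'X_[m] = \prod_(i < nvars n) F i :> zpoly.
  by rewrite mpolyXE_id; apply: eq_bigr => i _; rewrite /F inord_val.
rewrite /nvars big_ord_recl scalerAr; congr (_ * _).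
  have ord0E : inord (@ord0 (n.-1.*2)) = ivar0 n by rewrite inord_val.
  by rewrite /F ord0E.
(* Variables 2 i + 1 and 2 i + 2 form the pair of index k = i + 2. *)
rewrite (big_ord_double _ _ (fun k => F k.+1)) -scaler_prod.
apply: eq_bigr => i _; rewrite !ffunE !exprZn -scalerAl -scalerAr scalerA -exprD.
by rewrite mulrC.
Qed.

(** The coefficient family must be indexed by exponents: terms of the sum with
    equal exponents are collected, and [E] need not be injective. *)
Lemma evenB_sum (I : eqType) (s : seq I) (a : I -> R[i]) (E : I -> expo n) :
  (forall i, admB (E i)) -> (forall i, evenexp (E i)) ->
  evenB (\sum_(i <- s) a i *: polyB (E i)).
Proof.
move=> admE evenE; pose S := [fset e in map E s]%fset.
pose c : {fsfun expo n -> R[i] with 0} :=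
  [fsfun e in S => \sum_(i <- s | E i == e) a i].
have cS : (finsupp c `<=` S)%fset.
  apply/fsubsetP => e; rewrite mem_finsupp fsfunE.
  by case: ifP => // _; rewrite eqxx.
have im_c e : e \in finsupp c -> exists i, e = E i.
  by move=> /(fsubsetP cS); rewrite inE => /mapP[i _ ->]; exists i.
exists c; last by move=> e /im_c[i ->].
split=> [e /im_c[i ->] //|].
rewrite (big_fset_incl _ cS) => [|e _ eNc]; last first.
  by rewrite (fsfun_dflt eNc) mpolyC0 rmorph0 mul0r.
rewrite rmorph_sum /=.
under [RHS]eq_big_seq => e eS.
  rewrite fsfunE eS rmorph_sum rmorph_sum mulr_suml big_mkcond /=.
  over.
rewrite exchange_big /=; apply: eq_big_seq => i i_s.
have EiS : E i \in S by rewrite inE map_f.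
rewrite (bigD1_seq (E i)) ?fset_uniq //= eqxx big1 => [|e]; last first.
  by rewrite eq_sym => /negPf ->.
by rewrite addr0 monB_polyB // -rmorphM /= mul_mpolyC.
Qed.

(** One inclusion rewrites each B-product of an expansion as the image of an
    A-product; the other expands a preimage into monomials, hence into
    A-products. *)
Lemma evenB_Psi f : evenB f <-> exists g, f = Psi g.
Proof.
split=> [[c [admc fc] evenc] | [g ->]].
  exists (\sum_(e <- finsupp c) c e *: polyA (halfexp e)).
  apply/eqP; rewrite -tofrac_eq fc linear_sum rmorph_sum /=; apply/eqP.
  apply: eq_big_seq => e ec; rewrite monB_polyB ?admc // -rmorphM /= mul_mpolyC.
  have -> : polyB e = Psi (polyA (halfexp e)) by rewrite Psi_polyA halfexpK ?evenc.
  by rewrite linearZ.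
have [c cE] := choice mpolyX_polyA.
rewrite (mpolyE g) linear_sum.
have PsiX m : Psi 'X_[m] = c m *: polyB (dblexp (mexpo m)).
  by rewrite -Psi_polyA cE linearZ.
rewrite (eq_bigr (fun m => (g@_m * c m) *: polyB (dblexp (mexpo m)))); last first.
  by move=> m _; rewrite -scalerA -PsiX linearZ.
apply: evenB_sum => m; last exact: evenexp_dblexp.
by rewrite admB_dblexp admA_mexpo.
Qed.

(** Prescribing the values on the even B-products amounts to prescribing those
    of [Phi \o Psi] on the A-products, which span. *)
Lemma sends_B_to_AP (Phi : {linear zpoly -> zpoly}) :
  sends_B_to_A Phi <-> cancel Psi Phi.
Proof.
split=> [BA | PsiK e adm ev b bE].
  have PhiPsi e : admA e -> Phi (Psi (polyA e)) = polyA e.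
    move=> adm; have admd : admB (dblexp e) by rewrite admB_dblexp.
    apply/eqP; rewrite Psi_polyA -tofrac_eq -monA_polyA //; apply/eqP.
    rewrite -[in RHS](dblexpK e).
    by apply: BA; rewrite ?evenexp_dblexp ?monB_polyB.
  move=> f; rewrite -[LHS]/((Phi \o Psi) f) -[RHS]/(idfun f).
  apply: linear_mpoly_ext => m; have [c ->] := mpolyX_polyA m.
  by rewrite !linearZ; congr (_ *: _); apply/PhiPsi/admA_mexpo.
have -> : b = Psi (polyA (halfexp e)).
  by apply/eqP; rewrite Psi_polyA halfexpK // -tofrac_eq bE monB_polyB.
by rewrite PsiK monA_polyA // -admB_dblexp halfexpK.
Qed.

End Correspondence.

(** * The bijection *)

Theorem proposition4 (R : realType) (n : nat) (m : nat -> rat) (r : nat -> nat)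
  (hn : (2 <= n)%N) (hm : highest_weight n m)
  (hr : forall k : nat, (2 <= k <= n)%N -> (r k)%:R = m k - m k.-1)
  (hr1 : (r 1%N)%:R = 2 * m 1%N) :
  (exists Phi : {linear zpoly R n -> zpoly R n}, sends_B_to_A Phi) /\
  (forall Phi : {linear zpoly R n -> zpoly R n}, sends_B_to_A Phi ->
     set_bij (solB r `&` @evenB R n)%classic (solA (exponentsA r)) Phi).
Proof.
split=> [|Phi /sends_B_to_AP PsiK].
  by have [P PsiK] := Psi_retraction R n; exists P; apply/sends_B_to_AP.
split.
- by move=> f [solf /evenB_Psi[g fE]]; move: solf; rewrite fE PsiK;
  apply: (iffLR (solB_Psi r g hn)).
- move=> f f' /set_mem[_ /evenB_Psi[g ->]] /set_mem[_ /evenB_Psi[g' ->]].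
  move=> e; congr Psi; exact: (etrans (esym (PsiK g)) (etrans e (PsiK g'))).
- move=> g solg; exists (Psi g); last exact: (PsiK g).
  by split; [apply: (iffRL (solB_Psi r g hn)) | apply/evenB_Psi; exists g].
Qed.
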